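(* Let $X,Y$ be real normed vector spaces, $K\subseteq X$ a convex cone, $A:X\to Y$ a continuous linear operator, $b\in Y$, $c\in X^*$, and consider the primal problem: minimize $\langle c,x\rangle$ subject to $Ax=b$, $x\in K$, with optimal value $\hat f_p$, and the dual problem: maximize $\langle y,b\rangle$ subject to $-A^*y+c\in K^*$, $y\in Y^*$, with optimal value $\hat f_d$. Assume that the primal boundedness qualification (PBQ) holds with bound $\overline{x}\in K$. Let $\tilde y\in Y^*$, let $d:=-A^*\tilde y+c$, and let $\underline{d}^-\in X^*$ satisfy $\underline{d}^-\le d$ and $\underline{d}^-\le 0$. Then: (a) The primal optimal value is bounded from below by $$\hat f_p\ \ge\ \langle \tilde y,b\rangle+\langle \underline{d}^-,\overline{x}\rangle=:\underline{f}_p.$$ (b) If $\underline{d}^-=0$, then $\tilde y$ is dual feasible and $\hat f_d\ge \underline{f}_p=\langle\tilde y,b\rangle$; if moreover $\tilde y$ is dual optimal, then $\hat f_d=\underline{f}_p$.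
   Context: A convex cone $K\subseteq X$ satisfies $K+K\subseteq K$ and $\alpha K\subseteq K$ for all real $\alpha\ge 0$ (and contains $0$); it induces the reflexive and transitive relation $x\le y :\Leftrightarrow y-x\in K$ on $X$ (antisymmetry is not assumed). $X^*$ is the space of continuous linear functionals on $X$, $\langle y,x\rangle:=y(x)$, $K^*=\{y\in X^*:\langle y,x\rangle\ge 0\ \forall x\in K\}$, and $X^*$ is ordered by $K^*$: $u\le v:\Leftrightarrow v-u\in K^*$. $A^*:Y^*\to X^*$ is the adjoint of $A$. $\hat f_p$ is the infimum of the primal objective over the feasible set, with $\hat f_p:=+\infty$ if the primal is infeasible; $\hat f_d$ is the supremum of the dual objective over the dual feasible set, with $\hat f_d:=-\infty$ if the dual is infeasible. PBQ (with bound $\overline{x}\in K$): either (i) the primal problem is infeasible (in which case no condition is imposed on $\overline{x}\in K$), or (ii) $\hat f_p$ is finite and for every $\varepsilon>0$ there exists a primal feasible $x(\varepsilon)$ with $x(\varepsilon)\le\overline{x}$ and $\langle c,x(\varepsilon)\rangle-\hat f_p\le\varepsilon$. *)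

(* Defs.v *)
From HB Require Import structures.
From mathcomp Require Import all_boot all_order all_algebra.
From mathcomp Require Import all_classical all_reals all_analysis.

Set Implicit Arguments.
Unset Strict Implicit.
Unset Printing Implicit Defensive.

Import Order.TTheory GRing.Theory Num.Theory.
Import numFieldNormedType.Exports.
Local Open Scope classical_set_scope.
Local Open Scope ring_scope.

(* Continuous linear operators X -> Y, as a submodule of the pointwise module *)
(* X -> Y; the operator norm is not needed.                                   *)

Definition contlin_pred (R : realType) (X Y : normedModType R) :
  {pred X -> Y} := mem [set f : X -> Y | linear f /\ continuous f].

Record contlin (R : realType) (X Y : normedModType R) := ContLin {
  contlin_fun :> X -> Y;
  contlin_funP : contlin_fun \in @contlin_pred R X Y }.

Section ContLinTheory.
Context (R : realType) (X Y : normedModType R).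
Implicit Types f : contlin X Y.

Lemma contlin_predP (g : X -> Y) :
  g \in @contlin_pred R X Y <-> linear g /\ continuous g.
Proof. by rewrite /contlin_pred; split=> [/set_mem|/mem_set]. Qed.

Lemma contlin_submod_closed : submod_closed (@contlin_pred R X Y).
Proof.
split.
  by apply/contlin_predP; split=> [a x y|]; [rewrite scaler0 addr0
                                            |exact: cst_continuous].
move=> a g h /contlin_predP[gl gc] /contlin_predP[hl hc].
apply/contlin_predP; split=> [k x y|x].
  by rewrite !fctE /= gl hl !scalerDr !scalerA (mulrC a k) addrACA.
apply: (@cvgD _ _ _ _ _ (a \*: g) h); last exact: hc.
by apply: cvgZl_tmp; exact: gc.
Qed.

HB.instance Definition _ := GRing.isSubmodClosed.Build R (X -> Y)
  (@contlin_pred R X Y) contlin_submod_closed.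

HB.instance Definition _ := [isSub for @contlin_fun R X Y].
HB.instance Definition _ := [Choice of contlin X Y by <:].
HB.instance Definition _ := [SubChoice_isSubLmodule of contlin X Y by <:].

Lemma contlin_linear f : linear f.
Proof. by case/contlin_predP: (contlin_funP f). Qed.

Lemma contlin_continuous f : continuous f.
Proof. by case/contlin_predP: (contlin_funP f). Qed.

HB.instance Definition _ f :=
  GRing.isLinear.Build R X Y *:%R (contlin_fun f) (contlin_linear f).

Lemma contlinD f g x : (f + g) x = f x + g x. Proof. by []. Qed.
Lemma contlinN f x : (- f) x = - f x. Proof. by []. Qed.
Lemma contlinZ (a : R) f x : (a *: f) x = a *: f x. Proof. by []. Qed.
Lemma contlin0 x : (0 : contlin X Y) x = 0. Proof. by []. Qed.

End ContLinTheory.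

Notation topdual X := (contlin X (_^o)%type).

Section Adjoint.
Context (R : realType) (X Y : normedModType R) (A : contlin X Y).

Lemma adjoint_subproof (y : topdual Y) : y \o A \in @contlin_pred R X R^o.
Proof.
apply/contlin_predP; split=> [a u v|x] /=; first by rewrite !linearP.
by apply: continuous_comp; exact: contlin_continuous.
Qed.

Definition adjoint (y : topdual Y) : topdual X := ContLin (adjoint_subproof y).

Lemma adjointE (y : topdual Y) (x : X) : adjoint y x = y (A x).
Proof. by []. Qed.

End Adjoint.

Definition convex_cone (R : realType) (V : lmodType R) (K : set V) : Prop :=
  [/\ K 0,
      forall x y, K x -> K y -> K (x + y) &
      forall (a : R) x, 0 <= a -> K x -> K (a *: x)].

Definition cone_le (V : zmodType) (K : set V) (x y : V) : Prop := K (y - x).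

Definition dual_cone (R : realType) (X : normedModType R) (K : set X) :
  set (topdual X) := [set y | forall x, K x -> 0 <= y x].

Section ConicProgram.
Context (R : realType) (X Y : normedModType R).
Context (K : set X) (A : contlin X Y) (b : Y) (c : topdual X).

Definition primal_feasible : set X := [set x | A x = b /\ K x].

(* [ereal_inf set0 = +oo] and [ereal_sup set0 = -oo], so infeasible problems  *)
(* get the conventional optimal values.                                       *)
Definition primal_value : \bar R :=
  ereal_inf [set (c x)%:E | x in primal_feasible].

Definition dual_feasible : set (topdual Y) :=
  [set y | dual_cone K (- adjoint A y + c)].

Definition dual_value : \bar R :=
  ereal_sup [set (y b)%:E | y in dual_feasible].

Definition dual_optimal (y : topdual Y) : Prop :=
  dual_feasible y /\ forall z, dual_feasible z -> z b <= y b.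

Definition PBQ (xbar : X) : Prop :=
  K xbar /\
  (primal_feasible = set0 \/
   primal_value \is a fin_num /\
   forall eps : R, 0 < eps -> exists x : X,
     [/\ primal_feasible x, cone_le K x xbar &
         ((c x)%:E - primal_value <= eps%:E)%E]).

End ConicProgram.

(* Main.v *)
Require Import Defs.
From mathcomp Require Import all_boot all_order all_algebra.
From mathcomp Require Import all_classical all_reals all_analysis.

Import Order.TTheory GRing.Theory Num.Theory.
Import numFieldNormedType.Exports.
Local Open Scope classical_set_scope.
Local Open Scope ring_scope.

(** For a primal feasible [x], the reduced cost [d = c - A^* yt] satisfies
    [d x = c x - yt b].  Since [dm <= d] and [x] lies in [K], this is at least
    [dm x]; since [dm <= 0], the functional [dm] is order-reversing, so [dm x]
    is in turn at least [dm xbar] as soon as [x <= xbar].  Hence the bound of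
    (a) holds for the objective at every feasible point below [xbar]
    ([objective_ge_below]), and the boundedness qualification says that such
    points approximate the optimal value arbitrarily well.

    When [dm = 0], the inequality [dm <= d] is dual feasibility of [yt], and
    the correction term [dm xbar] vanishes, so (b) compares the dual value with
    the dual objective at the feasible point [yt]. *)

(** Both order relations on [dm] are used pointwise: [dm <= d] at [x] itself,
    and [dm <= 0] at the difference [xbar - x]. *)
Lemma objective_ge_below (R : realType) (X Y : normedModType R) (K : set X)
    (A : contlin X Y) (b : Y) (c : topdual X) (yt : topdual Y) (dm : topdual X)
    (x xbar : X) :
  cone_le (dual_cone K) dm (- adjoint A yt + c) ->
  cone_le (dual_cone K) dm 0 ->
  primal_feasible K A b x -> cone_le K x xbar ->
  yt b + dm xbar <= c x.
Proof.
move=> dm_d dm_0 [Axb Kx] x_xbar.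
have dx : 0 <= - yt b + c x - dm x by rewrite -Axb; exact: (dm_d x Kx).
have := dm_0 _ x_xbar.
rewrite contlinD contlin0 contlinN add0r linearB opprB subr_ge0 => dm_anti.
by rewrite -lerBrDl (le_trans dm_anti) // -subr_ge0 (addrC (c x)).
Qed.

(** Only feasible points below [xbar] have to be examined, since they contain a
    minimizing sequence; if there are none, the primal value is [+oo]. *)
Lemma primal_value_ge (R : realType) (X Y : normedModType R) (K : set X)
    (A : contlin X Y) (b : Y) (c : topdual X) (xbar : X) (r : R) :
  PBQ K A b c xbar ->
  (forall x, primal_feasible K A b x -> cone_le K x xbar -> r <= c x) ->
  (r%:E <= primal_value K A b c)%E.
Proof.
move=> [_ [infeasible|[fin_v approx]]] r_le.
  by rewrite /primal_value infeasible image_set0 ereal_inf0 leey.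
apply/lee_addgt0Pr => eps /approx[x [fx x_xbar]].
rewrite leeBlDr // addeC; apply: le_trans.
by rewrite lee_fin r_le.
Qed.

Lemma dual_value_optimal (R : realType) (X Y : normedModType R) (K : set X)
    (A : contlin X Y) (b : Y) (c : topdual X) (y : topdual Y) :
  dual_optimal K A b c y -> dual_value K A b c = (y b)%:E.
Proof.
move=> [fy y_max]; apply/eqP; rewrite eq_le; apply/andP; split.
  by apply: ge_ereal_sup => _ [z fz <-]; rewrite lee_fin y_max.
by apply: ereal_sup_ubound; exists y.
Qed.

Theorem theorem4p1 (R : realType) (X Y : normedModType R) (K : set X)
    (HK : convex_cone K) (A : contlin X Y) (b : Y) (c : topdual X)
    (xbar : X) (Hpbq : PBQ K A b c xbar)
    (yt : topdual Y) (dm : topdual X)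
    (Hdm_d : cone_le (dual_cone K) dm (- adjoint A yt + c))
    (Hdm_0 : cone_le (dual_cone K) dm 0) :
  let f_low : R := yt b + dm xbar in
  (f_low%:E <= primal_value K A b c)%E /\
  (dm = 0 ->
   [/\ dual_feasible K A c yt,
       (f_low%:E <= dual_value K A b c)%E,
       f_low = yt b &
       dual_optimal K A b c yt -> dual_value K A b c = f_low%:E]).
Proof.
move=> f_low; split.
  by apply: primal_value_ge Hpbq _ => x; exact: objective_ge_below.
move=> dm0.
have f_lowE : f_low = yt b by rewrite /f_low dm0 contlin0 addr0.
have yt_feas : dual_feasible K A c yt by move: Hdm_d; rewrite /cone_le dm0 subr0.
rewrite f_lowE; split=> //; last exact: dual_value_optimal.
by apply: ereal_sup_ubound; exists yt.
Qed.
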